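(* Let $X$ be a separable Banach space and $(T_s)_{s\geq 1}$ a countable family of bounded linear operators on $X$. Assume that there exist a dense linear subspace $X_0$ of $X$ with $T_s(X_0)\subset X_0$ and $X_0\subset \mathrm{Per}(T_s)$ for any $s\geq 1$, and a constant $\alpha \in (0,1)$ such that the following property holds: for every $s,q\geq 1$, every $\varepsilon>0$ and every $x,y\in X_0$, there exist $z\in X_0$ and integers $n,d\geq 1$ such that, for every $1\leq t \leq q$, (1) $d$ is a multiple of $p_{T_{t}}(y)$ and of $p_{T_{t}}(z)$; (2) $\Vert T_t^k(z)\Vert<\varepsilon$ for every $0\leq k\leq \alpha d$; (3) $\Vert T_s^{n+k}(z)-T_s^k(x)\Vert < \varepsilon$ for every $0\leq k\leq \alpha d$. Then there exists a common frequently hypercyclic vector for the family $(T_s)_{s \geq 1}$.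
   Context: For a bounded linear operator $T$ on $X$, $\mathrm{Per}(T)$ is the set of periodic points of $T$, i.e. the vectors $x\in X$ for which there is an integer $p\geq 1$ with $T^p(x)=x$. For $x\in\mathrm{Per}(T)$, $p_T(x)$ denotes the period of $x$ for $T$, i.e. the smallest positive integer $p$ with $T^p(x)=x$. A vector $x\in X$ is frequently hypercyclic for $T$ if for every non-empty open $U\subset X$, $\underline{d}(\{n\in\mathbb{N}:T^n(x)\in U\})>0$, where $\mathbb{N}=\{0,1,2,\ldots\}$ and $\underline{d}(E)=\liminf_{n\to\infty}\frac{\mathrm{card}([0,n]\cap E)}{n+1}$. A common frequently hypercyclic vector for a family is a vector frequently hypercyclic for each operator of the family. *)

(* Defs.v *)
From HB Require Import structures.
From mathcomp Require Import all_boot all_order all_algebra.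
From mathcomp Require Import all_classical all_reals all_analysis.
From mathcomp Require Import complex.

Set Implicit Arguments.
Unset Strict Implicit.
Unset Printing Implicit Defensive.

Import Order.TTheory GRing.Theory Num.Theory.
Import numFieldNormedType.Exports.

Local Open Scope classical_set_scope.
Local Open Scope ring_scope.

(* A Banach space is real or complex, so the scalar field is R or R[i].  In
   both cases norms take their values in the scalar field, and [0 < e] forces
   [e] to be a (positive) real number. *)
Definition real_or_complex (R : realType) (K : numFieldType) : Prop :=
  K = R :> numFieldType \/ K = R[i] :> numFieldType.

Section Defs.
Context {K : numFieldType} {X : normedModType K}.
Implicit Types (T : {linear X -> X}) (x : X).

Definition separable : Prop := exists D : set X, countable D /\ dense D.

Definition bounded_operator T : Prop :=
  exists M : K, forall x, `|T x| <= M * `|x|.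

Definition Per T : set X := [set x | exists2 p : nat, (1 <= p)%N & iter p T x = x].

(* The value 0 on non-periodic vectors is junk. *)
Definition period T x : nat :=
  match pselect (exists p : nat, (1 <= p)%N && (iter p T x == x)) with
  | left exp => ex_minn exp
  | right _ => 0%N
  end.

End Defs.

Arguments separable {K} X.

Definition lower_density (R : realType) (E : set nat) : \bar R :=
  limn_einf (fun n : nat =>
    ((#|[set k : 'I_n.+1 | nat_of_ord k \in E]%SET|%:R / n.+1%:R : R)%:E)).

Definition frequently_hypercyclic (R : realType) (K : numFieldType)
    (X : normedModType K) (T : {linear X -> X}) (x : X) : Prop :=
  forall U : set X, open U -> U !=set0 ->
    (0 < lower_density R [set n : nat | iter n T x \in U])%E.

(* Main.v *)
Require Import Defs.
From HB Require Import structures.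
From mathcomp Require Import all_boot all_order all_algebra.
From mathcomp Require Import all_classical all_reals all_analysis.
From mathcomp Require Import zify ring.
From mathcomp Require Import complex.

Set Implicit Arguments.
Unset Strict Implicit.
Unset Printing Implicit Defensive.

Import Order.TTheory GRing.Theory Num.Theory.
Import numFieldNormedType.Exports.

Local Open Scope classical_set_scope.
Local Open Scope ring_scope.

(** The vector is a limit of points [y j] of [X0], built so that [y j.+1 - y j]
    is small along the orbits of the first operators over a stretch of time
    that dominates the past.  The points of [X0] are periodic, so visits of
    their orbits to a ball have a frequency, and two effects compete.  Passing
    from [y j] to [y j.+1] keeps the old visits only during a fraction of the
    new period, so that their frequency is multiplied by a constant that
    depends on alpha.  On the other hand a step devoted to an operator
    [T s] and a target [x] makes the orbit of [y j.+1] under [T s] follow the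
    periodic orbit of [x] with a frequency that depends on alpha and on the
    period of [x], not on [y j].  Step [j] serves the task coded by the 2-adic
    valuation of [j + 1]: each task recurs with bounded gaps, so its frequency
    never falls below a fixed positive constant ([visits_persist],
    [limit_prefix_frequent]).

    The difficulty is in a single step.  An echo of [x] after [y] is a vector [z]
    that is small for a long time under all operators considered and satisfies
    [T s ^ (n + k) z ~ T s ^ k x].  Taking an echo of [x - y] would turn [y] into
    a vector that follows [x], provided that [n] is a multiple of the period of
    [y] under [T s].  But [n] is not under control, and for several operators
    replacing [z] by some [T s ^ i z] is useless, since that vector may be large
    along the orbits of another operator [T t].

    The residue of [n] is neutralised by a pigeonhole argument, with two echoes
    instead of one.  Let [w = y - x], of period [p] under [T s].  A vector has at
    least one residue mod [p] for which it has echoes that are arbitrarily small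
    and long ([recurrent_residue]).  Attach such a residue to each combination
    [sum_j f(j) T s ^ j w], [0 <= f(j) <= p].  This colours a cube of side [p + 1]
    and dimension [p] by its [p] directions, and then two points with the same
    colour [i] lie on a common line of direction [i] ([colouring_line]).  The two
    combinations differ by [r T s ^ i w] with an integer [r != 0], and at any time
    [m] where both echoes are heard, the difference of the echoes divided by [r]
    is close to [T s ^ m w = T s ^ m y - T s ^ m x]: adding it with the right sign
    replaces [T s ^ m y] by [T s ^ m x] ([two_echoes_cancel]).  If the second echo
    is much longer than the first one, then both are heard with frequency at least
    of order alpha^2. *)

(** * Counting visits in windows of time *)

Section WindowCounting.
Local Open Scope nat_scope.
Implicit Types (G : pred nat) (a b c d k m n A C L N W : nat).

Definition hits G a n : nat := count G (iota a n).

Lemma hits_split G a m n : hits G a (m + n) = hits G a m + hits G (a + m) n.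
Proof. by rewrite /hits iotaD count_cat. Qed.

Lemma hits_window G a N b n : a <= b -> b + n <= a + N ->
  hits G b n <= hits G a N.
Proof.
move=> ab bnaN; have -> : N = (b - a) + (n + (a + N - (b + n))) by lia.
by rewrite hits_split (subnKC ab) hits_split; lia.
Qed.

Lemma sub_hits G G' a n :
  (forall m, a <= m < a + n -> G m -> G' m) -> hits G a n <= hits G' a n.
Proof.
rewrite /hits; elim: n a => [//|n IHn] a GG' /=; apply: leq_add; last first.
  by apply: IHn => m am; apply: GG'; lia.
by case Ga : (G a) => //; rewrite GG' // leqnn; lia.
Qed.

(** Frequencies are compared with [1 / C] for natural numbers [C], so that all
    the counting stays in [nat]. *)
Definition frequent G L C := forall a N, L <= N -> N <= C * hits G a N.

Lemma frequent_tiling G W C : 0 < W -> (forall a, W <= C * hits G a W) ->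
  frequent G W (2 * C).
Proof.
move=> W0 GW a N WN.
have tile c : c * W <= C * hits G a (c * W).
  elim: c => [//|c IHc]; rewrite mulSn addnC hits_split mulnDr.
  by apply: leq_add => //; exact: GW.
have := tile (N %/ W); have := @hits_window G a N a (N %/ W * W) (leqnn _).
have := divn_eq N W; have := ltn_pmod N W0; have : 0 < N %/ W by rewrite divn_gt0.
set c := N %/ W; set r := N %% W; set x := c * W; set y := hits _ _ _.
move=> c0 rW Nx /(_ _)/[dup] yh _ xy.
have {yh} yh : y <= hits G a N by apply: yh; rewrite leq_add2l Nx leq_addr.
have Wx : W <= x by rewrite leq_pmull.
have : C * y <= C * hits G a N by rewrite leq_mul2l yh orbT.
by rewrite -mulnA; lia.
Qed.

Lemma frequent_multiples G P : 0 < P -> (forall m, P %| m -> G m) ->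
  frequent G P (2 * P).
Proof.
move=> P0 GP; apply: frequent_tiling => // a; apply: leq_pmulr.
have aE := divn_eq a P; have aP := ltn_pmod a P0.
have [r0|r0] := posnP (a %% P).
  apply: leq_trans (@hits_window G a P a 1 (leqnn _) _); last by rewrite leq_add2l.
  by rewrite /hits /= GP // /dvdn r0.
apply: leq_trans (@hits_window G a P (a %/ P * P + P) 1 _ _); try lia.
by rewrite /hits /= GP // dvdn_addl // dvdn_mull.
Qed.

(** A window of length [2 * d] contains a whole block of the times congruent to
    [n], ..., [n + d / A] modulo [d]; the visits to [G] inside it are kept. *)
Lemma frequent_blocks G G' L C A d n : 0 < A -> 0 < d -> A * L <= d ->
  frequent G L C ->
  (forall m k, A * k <= d -> m = n + k %[mod d] -> G m -> G' m) ->
  frequent G' (2 * d) (4 * (A * C)).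
Proof.
move=> A0 d0 ALd GC GG'; rewrite (_ : 4 * _ = 2 * (2 * (A * C))); last by rewrite !mulnA.
apply: frequent_tiling => [|a]; first by rewrite muln_gt0.
have aE := divn_eq (a + (d.-1 - n %% d)) d; have ad := ltn_pmod (a + (d.-1 - n %% d)) d0.
have nd := ltn_pmod n d0.
pose b := a + (d.-1 - (a + (d.-1 - n %% d)) %% d).
have bE : b = n %[mod d].
  have -> : b = n %% d + (a + (d.-1 - n %% d)) %/ d * d by rewrite /b; lia.
  by rewrite addnC modnMDl modn_mod.
have dA := divn_eq d A; have dAm := ltn_pmod d A0.
have Lk : L <= d %/ A by rewrite leq_divRL // mulnC.
have kd : (d %/ A).+1 <= d.+1 by rewrite ltnS leq_div.
have h1 : hits G b (d %/ A).+1 <= hits G' a (2 * d).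
  apply: leq_trans (@hits_window G' a (2 * d) b (d %/ A).+1 _ _); last 2 first.
  - by rewrite /b; lia.
  - by rewrite /b; lia.
  apply: sub_hits => m /andP[bm mb]; apply: (GG' m (m - b)).
  - by apply: (@leq_trans (A * (d %/ A))); [rewrite leq_mul2l; apply/orP; right; lia|lia].
  - by rewrite -modnDml -bE modnDml subnKC.
have := GC b (d %/ A).+1 (leqW Lk).
have : C * hits G b (d %/ A).+1 <= C * hits G' a (2 * d) by rewrite leq_mul2l h1 orbT.
set u := C * _; set v := C * hits _ _ _ => uv ku.
rewrite -!mulnA leq_pmul2l // -/v.
apply: (@leq_trans (A * (d %/ A).+1)); first by rewrite mulnS; lia.
by rewrite leq_mul2l (leq_trans ku uv) orbT.
Qed.

(** Unlike [frequent], only the windows that start at time 0 are considered: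
    this is what survives when a periodic orbit is perturbed, and what lower
    density measures. *)
Definition prefix_frequent G L C := forall N, L <= N -> N <= C * hits G 0 N.

(** Up to time [d / A] the visits to [G] are visits to [G'], and later on the
    period [d] of [G'] repeats them.  The threshold [L] is unchanged, although
    [d] may be much larger: this bounds the frequency uniformly between one
    step of the construction and the next. *)
Lemma prefix_frequent_periodic G G' L C A d : 0 < A -> 0 < L -> A * L <= d ->
  prefix_frequent G L C ->
  (forall m, A * m <= d -> G m -> G' m) ->
  (forall m, G' (m + d) = G' m) ->
  prefix_frequent G' L (4 * A * C).
Proof.
move=> A0 D0 ADd GC GG' G'd N DN.
have dA := divn_eq d A; have dAm := ltn_pmod d A0.
have Db : L <= d %/ A by rewrite leq_divRL // mulnC.
have G'G M : M <= (d %/ A).+1 -> hits G 0 M <= hits G' 0 M.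
  move=> Mb; apply: sub_hits => m /andP[_ mM]; apply: GG'.
  by apply: (@leq_trans (A * (d %/ A))); [rewrite leq_mul2l; apply/orP; right; lia|lia].
have [Nb|bN] := leqP N (d %/ A).
  apply: leq_trans (GC N DN) _; rewrite -mulnA mulnCA leq_mul2l.
  by apply/orP; right; apply: leq_trans (G'G N _) _; [lia | rewrite leq_pmull //; lia].
have db : d <= 2 * (A * C) * hits G' 0 (d %/ A).
  have h := GC _ Db; have := G'G (d %/ A) (leqnSn _).
  rewrite -(leq_pmul2l A0) => h2.
  have h3 : A * (d %/ A) <= A * (C * hits G' 0 (d %/ A)).
    rewrite leq_mul2l; apply/orP; right; apply: leq_trans h _.
    by rewrite leq_mul2l -(leq_pmul2l A0) h2 orbT.
  have : A <= A * (d %/ A) by rewrite leq_pmulr //; lia.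
  by rewrite -!mulnA; lia.
have [Nd|dN] := ltnP N d.
  have := @hits_window G' 0 N 0 (d %/ A) (leqnn _).
  rewrite !add0n => /(_ (ltnW bN)) h.
  apply: leq_trans (ltnW Nd) (leq_trans db _).
  by rewrite leq_mul // -mulnA leq_mul2r orbT.
have d0 : 0 < d by lia.
have dW a : d <= 2 * (A * C) * hits G' a d.
  have -> : hits G' a d = hits G' 0 d.
    elim: a => [//|a <-]; have := hits_split G' a 1 d.
    have -> : hits G' a (1 + d) = hits G' a d + hits G' a 1.
      by rewrite addnC hits_split {3}/hits /hits /= G'd.
    by rewrite addn1; lia.
  apply: leq_trans db _; rewrite leq_mul2l hits_window ?orbT // !add0n.
  by rewrite leq_div.
have := frequent_tiling d0 dW 0 dN.
by rewrite !mulnA.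
Qed.

End WindowCounting.

(** * A colouring of a cube *)

(** If no line of direction [i] carried two points of colour [i], a point [f] and
    a value [a] could be recovered from the colour of [f] and from [f] with its
    coordinate of that direction replaced by [a]; but there are [p + 1] values
    and only [p] colours. *)
Lemma colouring_line (p : nat) (c : {ffun 'I_p -> 'I_p.+1} -> 'I_p) :
  exists (f g : {ffun 'I_p -> 'I_p.+1}) (i : 'I_p),
    [/\ c f = i, c g = i, f i != g i & forall j, j != i -> f j = g j].
Proof.
pose upd (fa : {ffun 'I_p -> 'I_p.+1} * 'I_p.+1) :=
  (c fa.1, [ffun j => if j == c fa.1 then fa.2 else fa.1 j]).
have /injectivePn[[f a] [[g b] ab [cfg /ffunP uE]]] : ~~ injectiveb upd.
  apply/injectiveP => /leq_card; apply/negP; rewrite -ltnNge.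
  rewrite !card_prod !card_ord mulnC ltn_pmul2l //.
  by rewrite card_ffun !card_ord expn_gt0.
rewrite /= in cfg uE.
have fg j : j != c f -> f j = g j.
  by move=> jc; have := uE j; rewrite !ffunE -cfg (negPf jc).
exists f, g, (c f); split => //; apply/eqP => fgi; case/eqP: ab.
have := uE (c f); rewrite !ffunE -cfg eqxx => <-; congr (_, _).
by apply/ffunP => j; have [->|/fg] := eqVneq j (c f).
Qed.
(** * Iterates of a linear map *)

Section LinearIterates.
Context {K : nzRingType} {V : lmodType K}.
Implicit Types (f : {linear V -> V}) (x : V) (c d k m n : nat).

Lemma iter_is_linear f k : linear (iter k f).
Proof. by elim: k => [//|k IHk] a x y; rewrite /= IHk linearP. Qed.

HB.instance Definition _ f k :=
  GRing.isLinear.Build K V V *:%R (iter k f) (iter_is_linear f k).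

Lemma iter_fix_mul f d x c : iter d f x = x -> iter (c * d) f x = x.
Proof. by move=> fx; elim: c => [//|c IHc]; rewrite mulSn iterD IHc. Qed.

Lemma iter_fix_dvd f d x m : iter d f x = x -> (d %| m)%N -> iter m f x = x.
Proof. by move=> fx /dvdnP[c ->]; exact: iter_fix_mul. Qed.

Lemma iter_fix_mod f d x m n : iter d f x = x -> m = n %[mod d] ->
  iter m f x = iter n f x.
Proof.
have red k : iter d f x = x -> iter k f x = iter (k %% d) f x.
  by move=> fx; rewrite [in LHS](divn_eq k d) addnC iterD iter_fix_mul.
by move=> fx mn; rewrite red // mn -red.
Qed.
End LinearIterates.

Lemma iter_period (K : numFieldType) (X : normedModType K) (f : {linear X -> X})
  x d : (period f x %| d)%N -> iter d f x = x.
Proof.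
rewrite /period; case: pselect => [ex|_]; last by rewrite dvd0n => /eqP->.
by case: ex_minnP => m /andP[_ /eqP fx] _; exact: iter_fix_dvd.
Qed.

(** * Echoes with a recurrent residue *)

Section Construction.
Context {K : numFieldType} {X : normedModType K}.
Variables (T : nat -> {linear X -> X}) (X0 : set X) (A : nat).
Hypothesis A0 : (0 < A)%N.
Hypothesis X0_0 : X0 0.
Hypothesis X0_lin : forall (a : K) u v, X0 u -> X0 v -> X0 (a *: u + v).
Hypothesis X0_T : forall t u, (0 < t)%N -> X0 u -> X0 (T t u).
Hypothesis X0_Per : forall t u, (0 < t)%N -> X0 u -> Per (T t) u.
Hypothesis T_bounded : forall t, (0 < t)%N -> bounded_operator (T t).
Implicit Types (s t q d k m n : nat) (x y z w : X) (e : K).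

(** The data supplied by the hypothesis of the theorem.  The bound
    [k <= alpha * d] is replaced by the stronger [A * k <= d], for a natural
    number [A >= 1 / alpha]. *)
Record echo s q e x y z n d : Prop := Echo {
  echo_X0 : X0 z;
  echo_gt0 : (0 < d)%N;
  echo_fix : forall t, (0 < t <= q)%N -> iter d (T t) y = y /\ iter d (T t) z = z;
  echo_small : forall t k, (0 < t <= q)%N -> (A * k <= d)%N -> `|iter k (T t) z| < e;
  echo_copy : forall k, (A * k <= d)%N -> `|iter (n + k) (T s) z - iter k (T s) x| < e
}.

Hypothesis echo_ex : forall s q e x y, (0 < s)%N -> (0 < q)%N -> 0 < e ->
  X0 x -> X0 y -> exists z n d, echo s q e x y z n d.

Lemma X0_iter t k u : (0 < t)%N -> X0 u -> X0 (iter k (T t) u).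
Proof. by move=> t0 Xu; elim: k => [//|k IHk]; rewrite iterS; exact: X0_T. Qed.

Lemma X0_scale (a : K) u : X0 u -> X0 (a *: u).
Proof. by move=> Xu; rewrite -[a *: u]addr0; exact: X0_lin. Qed.

Lemma X0_add u v : X0 u -> X0 v -> X0 (u + v).
Proof. by rewrite -{2}[u]scale1r; exact: X0_lin. Qed.

Lemma X0_sub u v : X0 u -> X0 v -> X0 (u - v).
Proof. by move=> Xu Xv; rewrite -[- v]scaleN1r addrC; exact: X0_lin. Qed.

Lemma X0_sum (I : finType) (F : I -> X) : (forall i, X0 (F i)) -> X0 (\sum_i F i).
Proof. by move=> XF; elim/big_ind: _ => //; exact: X0_add. Qed.

Lemma common_period q x : X0 x ->
  exists2 L, (0 < L)%N & forall t, (0 < t <= q)%N -> iter L (T t) x = x.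
Proof.
move=> Xx; elim: q => [|q [L L0 LP]]; first by exists 1%N => // t; lia.
have [p p0 pP] := @X0_Per q.+1 x isT Xx.
exists (L * p)%N => [|t tq]; first by rewrite muln_gt0 L0.
have [->|tq'] := eqVneq t q.+1; first exact: iter_fix_mul.
by rewrite mulnC; apply/iter_fix_mul/LP; lia.
Qed.

(** Lets one vector stand for two in the parameter [y] of an echo.  If
    [T t ^ m] fixes both [a + c b] and [a + c' b] with [c != c'], then it fixes
    [a] and [b]; only finitely many pairs [(t, m)] matter, so that some integer
    [c] is bad for none of them. *)
Lemma joint_period q a b : X0 a -> X0 b -> exists2 w, X0 w &
  forall t d, (0 < t <= q)%N -> iter d (T t) w = w ->
    iter d (T t) a = a /\ iter d (T t) b = b.
Proof.
move=> Xa Xb; have [La La0 LaP] := common_period q Xa.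
have [Lb Lb0 LbP] := common_period q Xb.
pose L := (La * Lb)%N; have L0 : (0 < L)%N by rewrite muln_gt0 La0.
have aL t : (0 < t <= q)%N -> iter L (T t) a = a.
  by move=> tq; apply: iter_fix_dvd (LaP t tq) _; exact: dvdn_mulr.
have bL t : (0 < t <= q)%N -> iter L (T t) b = b.
  by move=> tq; apply: iter_fix_dvd (LbP t tq) _; exact: dvdn_mull.
apply: contrapT => noW.
have bad (c : nat) : exists tm : 'I_q.+1 * 'I_L, (0 < tm.1)%N /\
    iter tm.2 (T tm.1) (a + c%:R *: b) = a + c%:R *: b /\
    ~ (iter tm.2 (T tm.1) a = a /\ iter tm.2 (T tm.1) b = b).
  apply: contrapT => noTM; apply: noW; exists (a + c%:R *: b).
    by apply: X0_add => //; exact: X0_scale.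
  move=> t d tq wd; apply: contrapT => abd; apply: noTM.
  have t_lt : (t < q.+1)%N by lia.
  exists (Ordinal t_lt, Ordinal (ltn_pmod d L0)) => /=; split; first by lia.
  have modL u : iter L (T t) u = u -> iter (d %% L) (T t) u = iter d (T t) u.
    by move=> uL; apply: (iter_fix_mod uL); rewrite modn_mod.
  rewrite !modL ?aL ?bL //.
  by rewrite linearD linearZ /= aL // bL.
pose F (c : 'I_((q.+1 * L).+1)) := projT1 (cid (bad c)).
have FP c : (0 < (F c).1)%N /\
    iter (F c).2 (T (F c).1) (a + c%:R *: b) = a + c%:R *: b /\
    ~ (iter (F c).2 (T (F c).1) a = a /\ iter (F c).2 (T (F c).1) b = b).
  exact: (projT2 (cid (bad c))).
have /injectivePn[c [c' cc' Fcc']] : ~~ injectiveb F.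
  by apply/injectiveP => /leq_card; rewrite card_prod !card_ord ltnn.
have [_ [wc nc]] := FP c; have [_ [wc' _]] := FP c'.
rewrite -Fcc' in wc'; apply: nc; move: wc wc'.
rewrite !linearD !linearZ /=; set a' := iter _ _ a; set b' := iter _ _ b.
have solve (r : K) : a' + r *: b' = a + r *: b -> a' - a = r *: (b - b').
  move=> /(canRL (addrK _)) ->; rewrite scalerBr addrAC.
  by rewrite [a + _]addrC addrK.
move=> /solve wc /solve; rewrite wc => /eqP.
rewrite -subr_eq0 -scalerBl scaler_eq0 !subr_eq0 eqr_nat (inj_eq val_inj).
rewrite (negPf cc') /= => /eqP bb; split=> //.
by apply/eqP; rewrite -subr_eq0 wc bb subrr scaler0.
Qed.
Lemma iter_bounded t : (0 < t)%N ->
  exists2 M : K, 1 <= M & forall m x, `|iter m (T t) x| <= M ^+ m * `|x|.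
Proof.
move=> t0; have [M TM] := T_bounded t0.
have M1 : 1 <= `|M| + 1 by rewrite lerDr.
exists (`|M| + 1) => // m x; elim: m => [|m IHm]; first by rewrite mul1r.
rewrite iterS exprS -mulrA; set u := iter m _ _ in IHm *.
apply: le_trans (_ : (`|M| + 1) * `|u| <= _); last by rewrite ler_wpM2l // addr_ge0.
have [->|u0] := eqVneq u 0; first by rewrite linear0 normr0 mulr0.
apply: le_trans (TM u) _; rewrite ler_wpM2r //.
have M0 : 0 <= M by rewrite -(pmulr_lge0 _ (_ : 0 < `|u|)) ?normr_gt0 // (le_trans _ (TM u)).
by rewrite ger0_norm // lerDl.
Qed.

Lemma pos_lower (e1 e2 : K) : 0 < e1 -> 0 < e2 ->
  exists e, [/\ 0 < e, e <= e1 & e <= e2].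
Proof.
move=> e10 e20; have [le|/ltW le] := real_leP (gtr0_real e10) (gtr0_real e20).
- by exists e1.
- by exists e2.
Qed.

Lemma echo_weaken s q e e' x y y' z n d : (forall t m, (0 < t <= q)%N ->
    iter m (T t) y = y -> iter m (T t) y' = y') -> e <= e' ->
  echo s q e x y z n d -> echo s q e' x y' z n d.
Proof.
move=> yy' ee' [Xz d0 fx sm cp]; split=> //.
- by move=> t tq; have [fy fz] := fx t tq; split=> //; exact: yy'.
- by move=> t k tq kd; exact: lt_le_trans (sm t k tq kd) ee'.
- by move=> k kd; exact: lt_le_trans (cp k kd) ee'.
Qed.

(** The length [d] of an echo of [x != 0] is large when the echo is small enough:
    if [d < D], then [T s ^ n z = T s ^ (n %% d) z] has norm at most [M ^ D * e],
    too small to be close to [x].  For [x = 0] the zero vector is an echo of any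
    length. *)
Lemma long_echo s q e x y (D : nat) : (0 < s <= q)%N -> 0 < e -> X0 x -> X0 y ->
  exists z n d, echo s q e x y z n d /\ (D <= d)%N.
Proof.
move=> s0q; have /andP[s0 sq] := s0q; move=> e0 Xx Xy; have [x0|x0] := eqVneq x 0.
  have [L L0 LP] := common_period q Xy; exists 0, 0%N, (D.+1 * L)%N; split.
    split=> //; first by rewrite muln_gt0.
    - by move=> t tq; rewrite linear0; split=> //; apply/iter_fix_mul/LP.
    - by move=> t k _ _; rewrite linear0 normr0.
    - by move=> k _; rewrite x0 !linear0 addr0 normr0.
  by rewrite (leq_trans (leqnSn D)) // leq_pmulr.
have [M M1 TM] := iter_bounded s0.
have MD : 0 < M ^+ D + 1 by rewrite ltr_wpDl // exprn_ge0 // (le_trans ler01).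
have xM : 0 < `|x| / (M ^+ D + 1) by rewrite divr_gt0 ?normr_gt0.
have [e' [e'0 e'e e'x]] := pos_lower e0 xM.
have [z [n [d E]]] := echo_ex s0 (leq_trans s0 sq) e'0 Xx Xy.
exists z, n, d; split; first by apply: echo_weaken E.
rewrite leqNgt; apply/negP => dD.
have := echo_copy E (k := 0); rewrite muln0 addn0 => /(_ isT) /= Tnz.
have zE : iter n (T s) z = iter (n %% d) (T s) z.
  by apply: iter_fix_mod (echo_fix E s0q).2 _; rewrite modn_mod.
have ze : `|z| < e' by apply: (echo_small E (k := 0) s0q); rewrite muln0.
have : `|iter n (T s) z| <= M ^+ D * e'.
  rewrite zE; apply: le_trans (TM _ _) _; apply: ler_pM => //.
  - by rewrite exprn_ge0 // (le_trans ler01).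
  - by rewrite ler_weXn2l // ltnW // (leq_trans _ (ltnW dD)) // ltn_pmod // (echo_gt0 E).
  - exact: ltW.
move: e'x; rewrite ler_pdivlMr // mulrDr mulr1 mulrC => e'x Mz.
have : `|x| < `|x|; last by rewrite ltxx.
apply: lt_le_trans e'x; rewrite -[x in `|x|](subrK (iter n (T s) z)).
apply: le_lt_trans (ler_normD _ _) _; rewrite addrC distrC.
exact: ler_ltD.
Qed.

(** If each residue were missed for some choice of [e], [y] and [D], all of them
    would be missed for a common choice, since these parameters are directed
    (for [y] this is [joint_period]); but an echo has some residue. *)
Lemma recurrent_residue s q x p : (0 < s <= q)%N -> (0 < p)%N -> X0 x ->
  exists i : 'I_p, forall e y D, 0 < e -> X0 y ->
    exists z n d, [/\ echo s q e x y z n d, (D <= d)%N & n = i %[mod p]].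
Proof.
move=> sq p0 Xx; apply: contrapT => noi.
pose missed e y (D : nat) (i : nat) := forall z n d,
  echo s q e x y z n d -> (D <= d)%N -> n <> i %[mod p].
have miss1 (i : 'I_p) : exists e y (D : nat), [/\ 0 < e, X0 y & missed e y D i].
  apply: contrapT => nm; apply: noi; exists i => e y D e0 Xy.
  apply: contrapT => nz; apply: nm; exists e, y, D; split=> // z n d E Dd ni.
  by apply: nz; exists z, n, d.
have [e [y [D [e0 Xy miss]]]] : exists e y D,
    [/\ 0 < e, X0 y & forall i, (i < p)%N -> missed e y D i].
  suff: forall j, (j <= p)%N -> exists e y D,
      [/\ 0 < e, X0 y & forall i, (i < j)%N -> missed e y D i] by apply.
  elim=> [_|j IHj jp]; first by exists 1, 0, 0%N; split.
  have [e1 [y1 [D1 [e10 Xy1 m1]]]] := IHj (ltnW jp).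
  have [e2 [y2 [D2 [e20 Xy2 m2]]]] := miss1 (Ordinal jp).
  have [e [e0 ee1 ee2]] := pos_lower e10 e20.
  have [y Xy yP] := joint_period q Xy1 Xy2.
  exists e, y, (maxn D1 D2); split=> // i ij z n d E Dd.
  have [->|ij'] := eqVneq i j.
    apply: (m2 z n d); last by lia.
    by apply: echo_weaken E => // t m tq /(yP _ _ tq)[].
  apply: (m1 i _ z n d); [lia| |lia].
  by apply: echo_weaken E => // t m tq /(yP _ _ tq)[].
have [z [n [d [E Dd]]]] := long_echo D sq e0 Xx Xy.
by apply: (miss _ (ltn_pmod n p0) _ _ _ E Dd); rewrite modn_mod.
Qed.
(** * One step of the construction *)

Definition close t (u v : X) (r : K) : pred nat :=
  fun m => `|iter m (T t) u - v| < r.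

Lemma close_weaken t u u' v r r' m : `|iter m (T t) (u' - u)| < r' ->
  close t u v r m -> close t u' v (r + r') m.
Proof.
rewrite /close linearB => uu' uv; rewrite -(subrK (iter m (T t) u) (iter m (T t) u')).
by rewrite -addrA addrC (le_lt_trans (ler_normD _ _)) // ltrD.
Qed.

Lemma prefix_frequent_perturbed t y u v r e C D d : (0 < D)%N -> (A * D <= d)%N ->
  (forall k, (A * k <= d)%N -> `|iter k (T t) u| < e) ->
  iter d (T t) (y + u) = y + u ->
  prefix_frequent (close t y v r) D C ->
  prefix_frequent (close t (y + u) v (r + e)) D (4 * A * C).
Proof.
move=> D0 ADd ue yud yC; apply: (prefix_frequent_periodic A0 D0 ADd yC).
- by move=> m md; apply: close_weaken; rewrite addrC addKr; exact: ue.
- by move=> m; rewrite /close iterD yud.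
Qed.

Lemma period_fix t x : Per (T t) x ->
  (0 < period (T t) x)%N /\ iter (period (T t) x) (T t) x = x.
Proof.
move=> [p p0 px]; rewrite /period; case: pselect => [ex|[]].
  by case: ex_minnP => m /andP[m0 /eqP mx] _.
by exists p; rewrite p0 px eqxx.
Qed.

Lemma dist_nat_ge1 (a b : nat) : a != b -> 1 <= `|a%:R - b%:R : K|.
Proof.
wlog ab : a b / (b < a)%N => [ge1 /[dup]|_].
  by rewrite {1}neq_ltn => /orP[ab|ba] ne; [rewrite distrC|]; apply: ge1; rewrite // eq_sym.
by rewrite -natrB ?(ltnW ab) // normr_nat ler1n subn_gt0.
Qed.

(** At a time [m] heard in both echoes, [T ^ ka] and [T ^ kb] agree on the orbit
    of [w], because both precede [T ^ m] by the same residue [i].  Hence the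
    echoes differ by about [T ^ ka (xf - xg) = r T ^ (ka + i) w = r T ^ m w]: the
    shift by [i] built into [xf - xg] makes up for the residue of [na]. *)
Lemma two_echoes_cancel t (w x y za zb xf xg : X) (r e : K) p (i na nb ka kb da db m : nat) :
  1 <= `|r| -> (i < p)%N -> w = y - x -> iter p (T t) w = w ->
  iter da (T t) w = w -> iter db (T t) w = w ->
  iter da (T t) za = za -> iter db (T t) zb = zb ->
  xf - xg = r *: iter i (T t) w ->
  (forall k l, iter k (T t) w = iter l (T t) w -> iter k (T t) xg = iter l (T t) xg) ->
  na = i %[mod p] -> nb = i %[mod p] ->
  m = na + ka %[mod da] -> m = nb + kb %[mod db] ->
  `|iter (na + ka) (T t) za - iter ka (T t) xf| < e ->
  `|iter (nb + kb) (T t) zb - iter kb (T t) xg| < e ->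
  iter m (T t) x = x ->
  close t (y - r^-1 *: za + r^-1 *: zb) x (e *+ 2) m.
Proof.
move=> r1 ip wE wp wda wdb zada zbdb xfg xgw nai nbi mda mdb za_e zb_e mx.
have shift n k : n = i %[mod p] -> iter (n + k) (T t) w = iter (i + k) (T t) w.
  by move=> ni; apply: (iter_fix_mod wp); rewrite -modnDml ni modnDml.
have mka : iter m (T t) w = iter (i + ka) (T t) w.
  by rewrite (iter_fix_mod wda mda) shift.
have mkb : iter m (T t) w = iter (i + kb) (T t) w.
  by rewrite (iter_fix_mod wdb mdb) shift.
have wk : iter kb (T t) w = iter ka (T t) w.
  have back k : iter k (T t) w = iter (p - i) (T t) (iter (i + k) (T t) w).
    by rewrite -iterD addnA subnK ?(ltnW ip) // addnC iterD wp.
  by rewrite back -mkb mka -back.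
have key : iter ka (T t) xf - iter kb (T t) xg = r *: iter m (T t) w.
  by rewrite (xgw _ _ wk) -linearB xfg linearZ /= -iterD addnC mka.
have r0 : r != 0 by rewrite -normr_gt0 (lt_le_trans ltr01).
rewrite /close -[in X in _ - X]mx !linearD -scalerN !linearZ linearN /=.
rewrite (iter_fix_mod zada mda) (iter_fix_mod zbdb mdb).
set a := iter (na + ka) _ _ in za_e *; set b := iter (nb + kb) _ _ in zb_e *.
have -> : iter m (T t) y + r^-1 *: - a + r^-1 *: b - iter m (T t) x =
  r^-1 *: ((b - iter kb (T t) xg) - (a - iter ka (T t) xf)).
  have -> : iter m (T t) y = iter m (T t) x + r^-1 *: (iter ka (T t) xf - iter kb (T t) xg).
    by rewrite key scalerA mulVf // scale1r wE linearB addrC subrK.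
  rewrite addrC -!addrA addKr -!scalerDr; congr (_ *: _).
  by rewrite opprB [LHS]addrACA [LHS]addrA [RHS]addrC; congr (_ + b); exact: addrC.
rewrite normrZ normfV; apply: le_lt_trans (_ : 1 * _ < _).
  by apply: ler_wpM2r => //; rewrite invf_le1 // (lt_le_trans ltr01).
by rewrite mul1r mulr2n (le_lt_trans (ler_normB _ _)) // ltrD.
Qed.
(** The requirements on a step from [(y, D)] to [(y', D')] devoted to the target
    [x] under [T s]; [D] and [D'] are times from which visits are counted. *)
Record extension s q e x y (D : nat) y' (D' : nat) : Prop := Extension {
  ext_X0 : X0 y';
  ext_lt : (D < D')%N;
  ext_small : forall t m, (0 < t <= q)%N -> (m <= D)%N ->
    `|iter m (T t) (y' - y)| < e *+ 2;
  ext_keep : forall t v r C, (0 < t <= q)%N -> prefix_frequent (close t y v r) D C ->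
    prefix_frequent (close t y' v (r + e *+ 2)) D (4 * A * (4 * A * C));
  ext_visit : prefix_frequent (close s y' x (e *+ 2)) D'
    (4 * (A * (4 * (A * (2 * period (T s) x)))))
}.

(** Two perturbations, by an echo [za] and by a much longer echo [zb]; this is
    why the factor [4 * A] appears twice in [ext_keep], and why visits to [x] are
    found in blocks of blocks in [ext_visit]. *)
Lemma extension_ex s q e x y (D : nat) :
  (0 < s <= q)%N -> (0 < D)%N -> X0 y -> X0 x -> 0 < e ->
  exists y' D', extension s q e x y D y' D'.
Proof.
move=> sq D0 Xy Xx e0; have /andP[s0 _] := sq.
set P := period (T s) x; have [P0 xP] := period_fix (X0_Per s0 Xx).
have [p p0 pP] : exists2 p, (0 < p)%N & iter p (T s) (y - x) = y - x.
  by have [p p0 pP] := common_period q (X0_sub Xy Xx); exists p => //; exact: pP.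
set w := y - x in pP; have Xw : X0 w by exact: X0_sub.
pose comb (f : {ffun 'I_p -> 'I_p.+1}) := \sum_j (f j)%:R *: iter j (T s) w.
have Xcomb f : X0 (comb f) by apply: X0_sum => j; apply/X0_scale/X0_iter.
(* The colour of [f] is a recurrent residue of its combination. *)
pose c f := projT1 (cid (recurrent_residue sq p0 (Xcomb f))).
have cP f : forall e y D, 0 < e -> X0 y -> exists z n d,
    [/\ echo s q e (comb f) y z n d, (D <= d)%N & n = c f %[mod p]].
  exact: (projT2 (cid (recurrent_residue sq p0 (Xcomb f)))).
have [f [g [i [cf cg fg_i fg]]]] := colouring_line c.
pose r : K := (f i)%:R - (g i)%:R.
have r1 : 1 <= `|r| by apply: dist_nat_ge1.
have comb_fg : comb f - comb g = r *: iter i (T s) w.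
  rewrite /comb -sumrB (bigD1 i) //= big1 ?addr0 ?scalerBl // => j ji.
  by rewrite fg // subrr.
have comb_g k l : iter k (T s) w = iter l (T s) w ->
    iter k (T s) (comb g) = iter l (T s) (comb g).
  move=> wkl; rewrite /comb !linear_sum; apply: eq_bigr => j _.
  by rewrite !linearZ /= -!iterD ![(_ + j)%N]addnC !iterD wkl.
have [y1 Xy1 y1P] := joint_period q Xy Xx.
(* [y1] carries the periods of [y] and [x], and [y2] also that of [za]: thus
   [db] is a period of all four vectors. *)
have [za [na [da [Ea daD]]]] := cP f e y1 (A * (D + P))%N e0 Xy1.
rewrite cf => nai; have [y2 Xy2 y2P] := joint_period q Xy1 (echo_X0 Ea).
have [zb [nb [db [Eb dbD]]]] := cP g e y2 (A * (2 * da))%N e0 Xy2.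
rewrite cg => nbi; have da0 := echo_gt0 Ea; have db0 := echo_gt0 Eb.
have ADa : (A * D <= da)%N by apply: leq_trans daD; rewrite leq_mul2l leq_addr orbT.
have APa : (A * P <= da)%N by apply: leq_trans daD; rewrite leq_mul2l leq_addl orbT.
have dab : (da < 2 * db)%N.
  have : (2 * da <= A * (2 * da))%N by rewrite leq_pmull.
  lia.
have Dda : (D <= da)%N by apply: leq_trans ADa; rewrite leq_pmull.
have ADb : (A * D <= db)%N.
  by apply: leq_trans dbD; rewrite leq_mul2l; apply/orP; right; lia.
have fixa t : (0 < t <= q)%N ->
    [/\ iter da (T t) y = y, iter da (T t) x = x & iter da (T t) za = za].
  by move=> tq; have [/(y1P _ _ tq)[]] := echo_fix Ea tq.
have fixb t : (0 < t <= q)%N -> [/\ iter db (T t) y = y, iter db (T t) x = x,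
    iter db (T t) za = za & iter db (T t) zb = zb].
  by move=> tq; have [/(y2P _ _ tq)[/(y1P _ _ tq)[? ?] ?] ?] := echo_fix Eb tq.
have rV1 (u : X) : `|r^-1 *: u| <= `|u|.
  rewrite normrZ normfV -[leRHS]mul1r ler_wpM2r // invf_le1 //.
  exact: lt_le_trans r1.
pose ua := - (r^-1 *: za); pose ub := r^-1 *: zb.
have ua_small t k : (0 < t <= q)%N -> (A * k <= da)%N -> `|iter k (T t) ua| < e.
  move=> tq kd; rewrite linearN linearZ normrN.
  exact: le_lt_trans (rV1 _) (echo_small Ea tq kd).
have ub_small t k : (0 < t <= q)%N -> (A * k <= db)%N -> `|iter k (T t) ub| < e.
  by move=> tq kd; rewrite linearZ; exact: le_lt_trans (rV1 _) (echo_small Eb tq kd).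
exists (y + ua + ub), (2 * db)%N; split.
- by apply: X0_add; [apply: X0_sub => //|]; apply: X0_scale; [exact: echo_X0 Ea|exact: echo_X0 Eb].
- exact: leq_ltn_trans Dda dab.
- move=> t m tq mD; rewrite addrC -addrA addKr linearD mulr2n.
  apply: le_lt_trans (ler_normD _ _) _; apply: ltrD.
  + by apply: ua_small => //; apply: leq_trans ADa; rewrite leq_mul2l mD orbT.
  + by apply: ub_small => //; apply: leq_trans ADb; rewrite leq_mul2l mD orbT.
- move=> t v r' C tq yC; have [ya _ zaa] := fixa t tq; have [yb _ zab zbb] := fixb t tq.
  rewrite mulr2n addrA; apply: (prefix_frequent_perturbed (d := db)) => //.
  + by move=> k; exact: ub_small.
  + by rewrite /ua /ub !linearD linearN !linearZ /= yb zab zbb.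
  apply: (prefix_frequent_perturbed (d := da)) => //.
  + by move=> k; exact: ua_small.
  + by rewrite /ua linearD linearN linearZ /= ya zaa.
have [ya xa zaa] := fixa s sq; have [yb xb zab zbb] := fixb s sq.
(* Times at which [x] returns to itself, then those heard in the first echo,
   then those heard in both. *)
pose in_block n d m := exists2 k, (A * k <= d)%N & m = (n + k)%N %[mod d].
pose G0 : pred nat := fun m => iter m (T s) x == x.
pose G1 : pred nat := fun m => G0 m && `[< in_block na da m >].
pose G2 : pred nat := fun m => G1 m && `[< in_block nb db m >].
have G0P : frequent G0 P (2 * P).
  by apply: frequent_multiples => // m Pm; apply/eqP; exact: iter_fix_dvd xP Pm.
have G1P : frequent G1 (2 * da) (4 * (A * (2 * P))).
  apply: (frequent_blocks (n := na) A0 da0 APa G0P) => m k kd mk G0m.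
  by rewrite /G1 G0m /=; apply/asboolP; exists k.
have G2P : frequent G2 (2 * db) (4 * (A * (4 * (A * (2 * P))))).
  apply: (frequent_blocks (n := nb) A0 db0 dbD G1P) => m k kd mk G1m.
  by rewrite /G2 G1m /=; apply/asboolP; exists k.
move=> N dN; apply: leq_trans (G2P 0%N N dN) _; rewrite leq_mul2l; apply/orP; right.
apply: sub_hits => m _ /andP[/andP[/eqP mx /asboolP[ka kad mka]] /asboolP[kb kbd mkb]].
apply: (two_echoes_cancel r1 (ltn_ord i) (erefl w) pP _ _ zaa zbb comb_fg comb_g
  nai nbi mka mkb (echo_copy Ea kad) (echo_copy Eb kbd) mx).
- by rewrite /w linearB /= ya xa.
- by rewrite /w linearB /= yb xb.
Qed.
(** * The limit vector *)

Definition halves (i : nat) : K := 2^-1 ^+ i.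

Lemma halves_gt0 i : 0 < halves i. Proof. by rewrite exprn_gt0 // invr_gt0. Qed.

(** Makes the errors of successive steps telescope. *)
Lemma halves_double i : halves i *+ 2 = 4 * (halves i - halves i.+1).
Proof. by rewrite /halves exprS; field. Qed.

Lemma halves_le i j : (i <= j)%N -> halves j <= halves i.
Proof. by move=> ij; rewrite ler_wiXn2l // ?invr_ge0 // invf_le1 // ler1n. Qed.

(** The operators considered at step [j] are the first [s j + j], so that each
    operator is controlled from some step on. *)
Lemma extension_sequence (s : nat -> nat) (x : nat -> X) :
  (forall j, (0 < s j)%N) -> (forall j, X0 (x j)) ->
  exists (y : nat -> X) (D : nat -> nat), forall j,
    extension (s j) (s j + j) (halves j) (x j) (y j) (D j) (y j.+1) (D j.+1).
Proof.
move=> s0 Xx.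
have /choice[F FP] : forall jst : nat * (X * nat), exists st : X * nat,
    X0 jst.2.1 /\ (0 < jst.2.2)%N ->
    extension (s jst.1) (s jst.1 + jst.1) (halves jst.1) (x jst.1)
      jst.2.1 jst.2.2 st.1 st.2.
  move=> [j [y D]] /=; have [[Xy D0]|no] := pselect (X0 y /\ (0 < D)%N); last by exists (0, 0%N).
  have [|y' [D' E]] :=
    @extension_ex (s j) (s j + j) _ (x j) y D _ D0 Xy (Xx j) (halves_gt0 j).
    by rewrite s0 leq_addr.
  by exists (y', D').
pose st j := iteri j (fun j st => F (j, st)) (0, 1%N).
have stP j : X0 (st j).1 /\ (0 < (st j).2)%N.
  elim: j => [//|j /(FP (j, st j)) E]; split; first exact: ext_X0 E.
  exact: leq_ltn_trans (ext_lt E).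
by exists (fun j => (st j).1), (fun j => (st j).2) => j; exact: (FP (j, st j) (stP j)).
Qed.

Section Limit.
Variables (s : nat -> nat) (x y : nat -> X) (D : nat -> nat) (z : X).
Hypothesis yD : forall j,
  extension (s j) (s j + j) (halves j) (x j) (y j) (D j) (y j.+1) (D j.+1).
Hypothesis yz : forall e, 0 < e -> exists J, forall j, (J <= j)%N -> `|z - y j| < e.

Lemma extension_sequence_le i j : (i <= j)%N -> (D i <= D j)%N.
Proof.
by move=> /subnK <-; elim: (j - i)%N => // k IHk; apply: leq_trans IHk (ltnW (ext_lt (yD _))).
Qed.

Lemma extension_sequence_dist t i j m : (0 < t <= i)%N -> (i <= j)%N -> (m <= D i)%N ->
  `|iter m (T t) (y j - y i)| <= 4 * (halves i - halves j).
Proof.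
move=> ti /subnK <- mi; elim: (j - i)%N => [|k IHk].
  by rewrite !subrr linear0 normr0 mulr0.
rewrite addSn; set n := (k + i)%N in IHk *.
have -> : y n.+1 - y i = (y n.+1 - y n) + (y n - y i) by rewrite addrA subrK.
have -> : 4 * (halves i - halves n.+1) = halves n *+ 2 + 4 * (halves i - halves n).
  by rewrite halves_double; ring.
rewrite linearD (le_trans (ler_normD _ _)) // lerD //; apply/ltW/(ext_small (yD n)).
- by move: ti; rewrite /n; lia.
- by apply: leq_trans mi (extension_sequence_le _); rewrite /n leq_addl.
Qed.

Lemma limit_dist t i m : (0 < t <= i)%N -> (m <= D i)%N ->
  `|iter m (T t) (z - y i)| < 5 * halves i.
Proof.
move=> ti mi; have [M M1 TM] := iter_bounded (proj1 (andP ti)).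
have Mm0 : 0 < M ^+ m by rewrite exprn_gt0 // (lt_le_trans ltr01).
have [J yJ] := yz (divr_gt0 (halves_gt0 i) Mm0).
have -> : z - y i = (z - y (J + i)%N) + (y (J + i)%N - y i) by rewrite addrA subrK.
have -> : 5 * halves i = halves i + 4 * halves i by ring.
rewrite linearD (le_lt_trans (ler_normD _ _)) //; apply: ltr_leD.
  by apply: le_lt_trans (TM _ _) _; rewrite mulrC -ltr_pdivlMr // yJ // leq_addr.
apply: le_trans (extension_sequence_dist ti (leq_addl _ _) mi) _.
by rewrite ler_wpM2l // lerBlDr lerDl ltW // halves_gt0.
Qed.

(** The bound depends on the number [k] of steps since the target was served,
    but not on the step [i] at which this happened. *)
Lemma visits_persist t v i k : (0 < t <= i)%N -> s i = t -> x i = v ->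
  prefix_frequent (close t (y (i + k).+1) v (4 * (halves i - halves (i + k).+1)))
    (D (i + k).+1)
    (4 * (A * (4 * (A * (2 * period (T t) v)))) * (4 * A * (4 * A)) ^ k).
Proof.
move=> ti st xv; elim: k => [|k IHk].
  by rewrite addn0 muln1 -halves_double -st -xv; exact: ext_visit (yD i).
rewrite addnS; set n := (i + k).+1 in IHk *.
have tn : (0 < t <= s n + n)%N by move: ti; rewrite /n; lia.
move=> N DN; have := ext_keep (yD n) tn IHk (leq_trans (ltnW (ext_lt (yD n))) DN).
have -> : 4 * (halves i - halves n) + halves n *+ 2 = 4 * (halves i - halves n.+1).
  by rewrite halves_double; ring.
by rewrite expnS; congr leq; ring.
Qed.

(** Between the times [D j] and [D j.+1] the orbit of the limit is that of
    [y j.+1] up to a small error, and [y j.+1] keeps the visits of [y j] from the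
    time [D j] on, whereas the target was served at most [W] steps earlier. *)
Lemma limit_prefix_frequent t v W (r : K) i0 : (0 < t)%N ->
  (forall j, exists i, [/\ (j <= i < j + W)%N, s i = t & x i = v]) ->
  9 * halves i0 <= r -> exists C L, prefix_frequent (close t z v r) L C.
Proof.
move=> t0 rec ir; pose P := (4 * (A * (4 * (A * (2 * period (T t) v)))))%N.
exists (P * (4 * A * (4 * A)) ^ W)%N, (D (t + i0 + W)) => N DN.
have [j [tj Dj jD]] : exists j, [/\ (t + i0 + W <= j)%N, (D j <= N)%N & (N < D j.+1)%N].
  have Dj j : (j <= D j)%N by elim: j => // j /leq_ltn_trans; apply; exact: ext_lt (yD j).
  have ex : exists j, (D j <= N)%N by exists (t + i0 + W)%N.
  have ub j : (D j <= N)%N -> (j <= N)%N by apply: leq_trans.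
  case: (ex_maxnP ex ub) => j DjN jmax; exists j; split=> //; first exact: jmax.
  by rewrite ltnNge; apply/negP => /jmax; rewrite ltnn.
have [i [ij si xi]] := rec (j - W)%N.
have [k kW jE] : exists2 k, (k < W)%N & j = (i + k).+1 by exists (j - i.+1)%N; lia.
have ti : (0 < t <= i)%N by lia.
have tj' : (0 < t <= s j + j)%N by lia.
have := visits_persist (k := k) ti si xi; rewrite -jE -/P => /(ext_keep (yD j) tj') /(_ N Dj).
rewrite halves_double => NC; apply: leq_trans NC _; apply: leq_mul.
  rewrite mulnA mulnCA -expnS leq_mul2l; apply/orP; right.
  by rewrite leq_pexp2l // !muln_gt0 /= A0.
apply: sub_hits => m; rewrite add0n => /andP[_ mN] ym.
have mD : (m <= D j.+1)%N by rewrite ltnW // (ltn_trans mN).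
have tj1 : (0 < t <= j.+1)%N by lia.
apply: lt_le_trans (close_weaken (limit_dist tj1 mD) ym) _; apply: le_trans ir.
have hi : halves i <= halves i0 by apply: halves_le; lia.
have hj : halves j.+1 <= halves i by apply: halves_le; lia.
rewrite (_ : _ + _ = 4 * halves i + halves j.+1); last by rewrite /=; ring.
rewrite (_ : 9 * _ = 4 * halves i0 + 5 * halves i0); last by ring.
apply: lerD; first by rewrite ler_wpM2l.
by rewrite (le_trans hj) // (le_trans hi) // ler_peMl ?ler1n // ltW ?halves_gt0.
Qed.
End Limit.
End Construction.
(** * Lower density, dense targets and the order of the tasks *)

Lemma lower_density_gt0 (R : realType) (E : set nat) (G : pred nat) C L :
  (forall m, G m -> E m) -> prefix_frequent G L C -> (0 < lower_density R E)%E.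
Proof.
move=> GE GC; have C0 : (0 < C)%N.
  by have := GC L.+1 (leqnSn _); case: (C) => //; rewrite mul0n.
rewrite /lower_density limn_einf_lim; set u := fun n : nat => _.
apply: (@lt_le_trans _ _ (C%:R^-1 : R)%:E); first by rewrite lte_fin invr_gt0 ltr0n.
apply: lime_ge; first exact: is_cvg_einfs.
near=> n; apply: le_ereal_inf_tmp => _ [m /= nm <-].
rewrite /u lee_fin ler_pdivlMr ?ltr0n // ler_pdivrMl ?ltr0n // -natrM ler_nat.
have Lm : (L <= m.+1)%N by rewrite leqW // (leq_trans _ nm) //; near: n; exists L.
apply: leq_trans (GC m.+1 Lm) _; rewrite leq_mul2l; apply/orP; right.
have -> : hits G 0 m.+1 = \sum_(0 <= i < m.+1 | G i) 1.
  by rewrite /hits -sum1_count /index_iota subn0.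
rewrite big_mkord.
rewrite sum1dep_card; apply/subset_leq_card/fintype.subsetP => k.
by rewrite !inE; exact: GE.
Unshelve. all: by end_near. Qed.

(** The scalars may be complex, so that positive radii are complex numbers with a
    positive real part and no imaginary part. *)
Lemma halves_small (R : realType) (K : numFieldType) : real_or_complex R K ->
  forall r : K, 0 < r -> exists i : nat, 2^-1 ^+ i < r.
Proof.
have real_small (r : R) : 0 < r -> exists i : nat, 2^-1 ^+ i < r.
  move=> r0; exists (Num.bound r^-1).
  rewrite exprVn invf_plt ?posrE ?exprn_gt0 //.
  apply: lt_le_trans (archi_boundP _) _; first by rewrite invr_ge0 ltW.
  by rewrite -natrX ler_nat ltnW // ltn_expl.
case=> ->; first exact: real_small.
move=> [a b]; rewrite ltcE /= => /andP[/eqP b0 a0].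
have [i ia] := real_small a a0; exists i.
have -> : (2^-1 : R[i]) ^+ i = ((2^-1 : R) ^+ i)%:C%C.
  by rewrite rmorphXn /= fmorphV /= rmorph_nat.
by rewrite ltcE /= -b0 eqxx ia.
Qed.

Lemma complete_limit (K : numFieldType) (X : completeNormedModType K) (y : nat -> X) :
  (forall e : K, 0 < e -> exists J, forall j, (J <= j)%N -> `|y j - y J| < e) ->
  exists z : X, forall e : K, 0 < e -> exists J, forall j, (J <= j)%N -> `|z - y j| < e.
Proof.
move=> cy; have /cauchy_cvgP yl : cauchy (y @ \oo).
  apply: cauchy_exP => e e0; have [J yJ] := cy e e0; exists (y J); exists J => // j /= Jj.
  by rewrite -ball_normE /ball_ /= distrC; exact: yJ.
exists (lim (y @ \oo)) => e e0.
have /cvgrPdist_lt/(_ e e0)[J _ yJ] : y @ \oo --> lim (y @ \oo) by [].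
by exists J => j Jj; exact: yJ.
Qed.

Lemma separable_sequence (K : numFieldType) (X : normedModType K) : separable X ->
  exists f : nat -> X, forall U : set X, open U -> U !=set0 -> exists n, U (f n).
Proof.
move=> [S [/pfcard_geP[S0|[f]] dS]].
  by exists (fun=> 0) => U oU U0; have [u [_]] := dS U U0 oU; rewrite S0.
exists f => U oU U0; have [u [Uu Su]] := dS U U0 oU.
have [n _ fn] := @surj _ _ _ _ f u Su; by exists n; rewrite fn.
Qed.

(** The 2-adic valuation takes each value [e] periodically, with period
    [2 ^ e.+1]. *)
Lemma ruler_gap e j : exists i, (j <= i < j + 2 ^ e.+1)%N /\ logn 2 i.+1 = e.
Proof.
have p0 : (0 < 2 ^ e)%N by rewrite expn_gt0.
pose c := ((j + 2 ^ e) %/ 2 ^ e.+1)%N; exists ((c.*2.+1) * 2 ^ e).-1%N.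
have q0 : (0 < 2 ^ e.+1)%N by rewrite expn_gt0.
have E := divn_eq (j + 2 ^ e) (2 ^ e.+1); have M := ltn_pmod (j + 2 ^ e) q0.
have iE : (c.*2.+1 * 2 ^ e = c * 2 ^ e.+1 + 2 ^ e)%N.
  by rewrite mulSn -muln2 -mulnA -expnS addnC.
rewrite -/c in E; split; first by move: M E p0; rewrite iE expnS; lia.
by rewrite prednK ?muln_gt0 // lognM // pfactorK // lognE /= dvdn2 /= odd_double.
Qed.
Theorem theorem3p1 (R : realType) (K : numFieldType)
    (RK : real_or_complex R K) (X : completeNormedModType K)
    (sepX : separable X)
    (T : nat -> {linear X -> X})
    (bT : forall s : nat, (1 <= s)%N -> bounded_operator (T s))
    (X0 : set X) (linX0 : submod_closed (mem X0)) (denseX0 : dense X0)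
    (TX0 : forall s : nat, (1 <= s)%N -> T s @` X0 `<=` X0)
    (PerX0 : forall s : nat, (1 <= s)%N -> X0 `<=` Per (T s))
    (alpha : R) (alpha01 : 0 < alpha < 1)
    (H : forall s q : nat, (1 <= s)%N -> (1 <= q)%N ->
         forall e : K, 0 < e ->
         forall x y : X, X0 x -> X0 y ->
         exists (z : X) (n d : nat), [/\ X0 z, (1 <= n)%N, (1 <= d)%N &
           forall t : nat, (1 <= t <= q)%N ->
           [/\ (period (T t) y %| d)%N /\ (period (T t) z %| d)%N,
               forall k : nat, k%:R <= alpha * d%:R ->
                 `|iter k (T t) z| < e &
               forall k : nat, k%:R <= alpha * d%:R ->
                 `|iter (n + k) (T s) z - iter k (T s) x| < e]]) :
  exists x : X, forall s : nat, (1 <= s)%N -> frequently_hypercyclic R (T s) x.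
Proof.
have [alpha0 _] := andP alpha01.
pose A := (Num.bound alpha^-1).+1.
have Aalpha (k d : nat) : (A * k <= d)%N -> k%:R <= alpha * d%:R.
  move=> Akd; rewrite -ler_pdivrMl //; apply: le_trans (_ : (A * k)%:R <= _).
    rewrite natrM ler_wpM2r // (le_trans (ltW (archi_boundP _))) ?ler_nat //.
    by rewrite invr_ge0 ltW.
  by rewrite ler_nat.
have [X0_0 X0_lin] : X0 0 /\ forall (a : K) u v, X0 u -> X0 v -> X0 (a *: u + v).
  case: linX0 => z0 zl; split; first by move: z0; rewrite in_setE.
  by move=> a u v /mem_set Xu /mem_set Xv; have := zl a u v Xu Xv; rewrite in_setE.
have X0_T t u : (0 < t)%N -> X0 u -> X0 (T t u).
  by move=> t0 Xu; apply: (TX0 t t0); exists u.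
have X0_Per t u : (0 < t)%N -> X0 u -> Per (T t) u by move=> t0; exact: PerX0.
have echoes s q (e : K) x y : (0 < s)%N -> (0 < q)%N -> 0 < e -> X0 x -> X0 y ->
    exists z n d, echo T X0 A s q e x y z n d.
  move=> s0 q0 e0 Xx Xy; have [z [n [d [Xz _ d0 P]]]] := H s q s0 q0 e e0 x y Xx Xy.
  exists z, n, d; split=> //.
  - by move=> t /P[[? ?] _ _]; split; exact: iter_period.
  - by move=> t k /P[_ + _] /Aalpha; apply.
  - by have [|_ _ cp] := P 1%N; [rewrite q0|move=> k /Aalpha; exact: cp].
have [f fP] := separable_sequence sepX.
have /choice[x xP] : forall ln : nat * nat, exists u, X0 u /\ `|f ln.1 - u| < halves ln.2.
  move=> [l n]; have [||u [/= Uu Xu]] := denseX0 (ball (f l) (halves n)).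
  - by exists (f l); apply: ballxx; exact: halves_gt0.
  - by apply: ball_open; exact: halves_gt0.
  by exists u; split=> //; move: Uu; rewrite -ball_normE.
(* A task: an operator, and a point of [X0] close to the [l]-th term of a dense sequence,
   up to [2 ^ -n]. *)
pose task j : nat * (nat * nat) := odflt (0, (0, 0))%N (unpickle (logn 2 j.+1)).
have task_gap w j : exists i, (j <= i < j + 2 ^ (pickle w).+1)%N /\ task i = w.
  have [i [ij iw]] := ruler_gap (pickle w) j.
  by exists i; split=> //; rewrite /task iw pickleK.
have [|||y [D yD]] := extension_sequence _ X0_0 X0_lin X0_T X0_Per bT echoes
  (s := fun j => (task j).1.+1) (x := fun j => x (task j).2) => //.
  by move=> j; have [] := xP (task j).2.
have [z yz] : exists z : X, forall e : K, 0 < e ->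
    exists J, forall j, (J <= j)%N -> `|z - y j| < e.
  apply: complete_limit => e e0; have [i ie] := halves_small RK (divr_gt0 e0 (ltr0Sn K 3)).
  exists i.+1 => j ij.
  have := extension_sequence_dist (ltn0Sn _) yD (t := 1) (i := i.+1) (m := 0) isT ij isT.
  move=> /le_lt_trans; apply; rewrite mulrC -ltr_pdivlMr //.
  apply: le_lt_trans ie; apply: le_trans (halves_le (leqnSn i)).
  by rewrite lerBlDr lerDl ltW ?halves_gt0.
exists z => s s0 U oU [u0 Uu0]; have [l Ul] := fP U oU (ex_intro _ _ Uu0).
(* Half of [r] pays for the distance from the target to [f l], the other half
   for the distance from the orbit to the target. *)
have /nbhs_ballP[r /= r0 rU] : nbhs (f l) U by exact: open_nbhs_nbhs.
have [n nr] := halves_small RK (divr_gt0 r0 (ltr0Sn K 1)).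
have [i ir] := halves_small RK (divr_gt0 (divr_gt0 r0 (ltr0Sn K 1)) (ltr0Sn K 8)).
have [Xx fx] := xP (l, n).
have [C [L zC]] : exists C L, prefix_frequent (close T s z (x (l, n)) (r / 2)) L C.
  apply: (limit_prefix_frequent (ltn0Sn _) bT yD yz s0
    (W := 2 ^ (pickle (s.-1, (l, n))).+1) (i0 := i)) => //.
    move=> j; have [k [kj tk]] := task_gap (s.-1, (l, n)) j.
    by exists k; split; rewrite // tk //= prednK.
  by rewrite mulrC -ler_pdivlMr // ltW.
apply: lower_density_gt0 zC => m; rewrite /close => zx; rewrite /= inE; apply: rU.
rewrite -ball_normE /ball_ /= -(subrK (x (l, n)) (f l)) -addrA [r]splitr.
by rewrite (le_lt_trans (ler_normD _ _)) // ltrD // ?(lt_trans fx) // distrC.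
Qed.
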